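(* The signed measures $\nu_{n,1}^{\ast}$ (the $1$-splitting measures on the symmetric groups $S_n$) have the following properties. (1) The support of the measure $\nu_{n,1}^{\ast}$ is exactly the set of conjugacy classes $C_\lambda$ of $S_n$ such that $\lambda$ is one of: (i) rectangular partitions $\lambda=[b^a]$ for $ab=n$; (ii) almost-rectangular partitions $\lambda=[d^c,1]$ for $cd=n-1$. (2) The measure $\nu_{n,1}^{\ast}$ is a sum of two signed measures on $S_n$, $$\nu_{n,1}^{\ast}=\omega_n+\omega_{n-1}^{\ast},$$ which are uniquely characterized for all $n\ge1$ by the following two properties: (P1) $\omega_n$ is supported on the rectangular partitions $[b^a]$ of $S_n$; (P2) $\omega_{n-1}^{\ast}$ is supported on the almost-rectangular partitions of $S_n$, those of the form $[d^c,1]$, and is obtained from $\omega_{n-1}$ on $S_{n-1}$ as follows: for $\lambda\vdash n$, $$\omega_{n-1}^{\ast}(C_\lambda):=\begin{cases}\omega_{n-1}(C_{\lambda'}) & \text{if } \lambda=[\lambda',1] \text{ with } \lambda'\vdash n-1,\\ 0&\text{otherwise.}\end{cases}$$ The supports of $\omega_n$ and $\omega_{n-1}^{\ast}$ overlap on the identity conjugacy class $C_{[1^n]}$, viewing $[1^n]$ as being both rectangular and almost-rectangular. (3) For $n\ge 2$, $$\nu_{n,1}^{\ast}(C_{[1^n]})=\frac{(-1)^n}{n(n-1)}.$$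
   Context: A partition $\lambda\vdash n$ is written $[n^{m_n},\dots,2^{m_2},1^{m_1}]$, where $m_j=m_j(\lambda)$ is the number of parts equal to $j$ (only parts with $m_j\ge1$ are shown); $[\lambda',1]$ is the partition obtained from $\lambda'$ by adjoining one part equal to $1$. $C_\lambda\subset S_n$ is the conjugacy class of permutations of cycle type $\lambda$; a measure that is constant on conjugacy classes is said to be supported on certain partitions if it is supported on the corresponding classes. For a function $f$ on $S_n$ and $Y\subseteq S_n$, $f(Y):=\sum_{g\in Y}f(g)$. The $m$-th necklace polynomial is $M_m(X)=\frac1m\sum_{d\mid m}\mu(d)X^{m/d}$ ($\mu$ the Möbius function). The cycle polynomial of $\lambda\vdash n$ is $N_\lambda(X)=\prod_{j=1}^n\binom{M_j(X)}{m_j(\lambda)}$, where $\binom{t}{k}=\frac{t(t-1)\cdots(t-k+1)}{k!}$. For a complex parameter $z$ the $z$-splitting measure on $S_n$ is the measure, constant on conjugacy classes, with $\nu_{n,z}^{\ast}(C_\lambda)=\frac{1}{z^{n-1}(z-1)}N_\lambda(z)$. For $n\ge 2$ every $N_\lambda(X)$ is divisible by $X-1$, so the value at $z=1$ is well defined after cancelling this factor: $\nu_{n,1}^{\ast}(C_\lambda)=\left.\frac{N_\lambda(X)}{X^{n-1}(X-1)}\right|_{X=1}$. This is the $1$-splitting measure. For $n=1$, $\nu_{1,1}^{\ast}(C_{[1]})=1$. *)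

(* Defs.v *)
From HB Require Import structures.
From mathcomp Require Import all_boot all_order all_algebra all_fingroup.

Set Implicit Arguments.
Unset Strict Implicit.
Unset Printing Implicit Defensive.

Import Order.TTheory GRing.Theory Num.Theory.
Local Open Scope ring_scope.

(* Partitions are nonincreasing sequences of positive parts, so that          *)
(* [b^a] is [nseq a b] and [la', 1] is [rcons la' 1].                         *)
Definition is_partn (n : nat) (la : seq nat) : bool :=
  [&& sorted geq la, 0%N \notin la & sumn la == n].

Definition cycle_type (n : nat) (g : 'S_n) : seq nat :=
  sort geq [seq #|(X : {set 'I_n})| | X in porbits g].

Definition cycle_class (n : nat) (la : seq nat) : {set 'S_n} :=
  [set g : 'S_n | cycle_type g == la].

Definition rectangular (n : nat) (la : seq nat) : Prop :=
  exists a b : nat, [/\ (0 < a)%N, (0 < b)%N, (a * b = n)%N & la = nseq a b].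

(* [c] and [d] are positive; hence 1 has no almost-rectangular partition.     *)
Definition almost_rectangular (n : nat) (la : seq nat) : Prop :=
  exists c d : nat,
    [/\ (0 < c)%N, (0 < d)%N, ((c * d).+1 = n)%N & la = rcons (nseq c d) 1%N].

Definition mobius (d : nat) : int :=
  if all (fun p => logn p d == 1%N) (primes d) then (-1) ^+ size (primes d)
  else 0.

Section Measures.

Variable R : realFieldType.

Definition mass (n : nat) (f : {ffun 'S_n -> R}) (Y : {set 'S_n}) : R :=
  \sum_(g in Y) f g.

Definition class_constant (n : nat) (f : {ffun 'S_n -> R}) : Prop :=
  forall g h : 'S_n, f (g ^ h)%g = f g.

Definition charges (n : nat) (f : {ffun 'S_n -> R}) (la : seq nat) : Prop :=
  mass f (cycle_class n la) != 0.

Definition supported_on (n : nat) (f : {ffun 'S_n -> R})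
    (P : seq nat -> Prop) : Prop :=
  forall la : seq nat, is_partn n la -> charges f la -> P la.

(* The measure, constant on conjugacy classes, giving mass [v la] to the      *)
(* class of cycle type [la].                                                  *)
Definition class_measure (n : nat) (v : seq nat -> R) : {ffun 'S_n -> R} :=
  [ffun g : 'S_n => v (cycle_type g) / #|cycle_class n (cycle_type g)|%:R].

Lemma mass_class_measure (n : nat) (v : seq nat -> R) (la : seq nat) :
  cycle_class n la != set0 ->
  mass (class_measure n v) (cycle_class n la) = v la.
Proof.
move=> nz; rewrite /mass.
rewrite (eq_bigr (fun=> v la / #|cycle_class n la|%:R)); last first.
  by move=> g; rewrite inE ffunE => /eqP ->.
rewrite sumr_const -[LHS]mulr_natr divfK // pnatr_eq0 -lt0n card_gt0.
exact: nz.
Qed.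

Definition necklace_poly (m : nat) : {poly R} :=
  m%:R^-1 *: \sum_(d <- divisors m) (mobius d)%:~R *: 'X^(m %/ d).

Definition binom_poly (t : {poly R}) (k : nat) : {poly R} :=
  k`!%:R^-1 *: \prod_(i < k) (t - i%:R).

Definition cycle_poly (n : nat) (la : seq nat) : {poly R} :=
  \prod_(1 <= j < n.+1) binom_poly (necklace_poly j) (count_mem j la).

(* N_la(X) / (X^(n-1) (X - 1)) at X = 1, after exact division of N_la(X) by   *)
(* X - 1; this is possible for n >= 2, while n = 1 has its own convention.    *)
(* The value for n = 0 has no meaning.                                        *)
Definition splitting1_mass (n : nat) (la : seq nat) : R :=
  if n == 1%N then 1
  else (cycle_poly n la %/ ('X - 1)).[1] / ('X^(n.-1) : {poly R}).[1].

Definition splitting1 (n : nat) : {ffun 'S_n -> R} :=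
  class_measure n (splitting1_mass n).

(* w^* on S_(n+1), for w on S_n. A partition has the form [la', 1] exactly    *)
(* when 1 is one of its parts, and then la' is obtained by removing it.       *)
Definition star (n : nat) (w : {ffun 'S_n -> R}) : {ffun 'S_n.+1 -> R} :=
  class_measure n.+1 (fun la =>
    if 1%N \in la then mass w (cycle_class n (rem 1%N la)) else 0).

Definition splitting1_decomposition (w : forall n : nat, {ffun 'S_n -> R})
    : Prop :=
  (forall n : nat, class_constant (w n)) /\
  forall n : nat,
    [/\ splitting1 n.+1 = w n.+1 + star (w n),
        supported_on (w n.+1) (rectangular n.+1)
      & supported_on (star (w n)) (almost_rectangular n.+1)].

End Measures.

(* Main.v *)
Require Import Defs.
From HB Require Import structures.
From mathcomp Require Import all_boot all_order all_algebra all_fingroup ring.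

Set Implicit Arguments.
Unset Strict Implicit.
Unset Printing Implicit Defensive.

Import Order.TTheory GRing.Theory Num.Theory.
Local Open Scope ring_scope.

(** For [n >= 2] the mass of the class of [la] is the derivative at [1] of the
    cycle polynomial, because dividing by [X - 1] a polynomial that vanishes at
    [1] and then evaluating at [1] is differentiating there. The cycle
    polynomial is a product with one factor for each [j]. Since
    [M_1 = X] and [M_j(1) = 0] for [j > 1], the factor of index [j] is [1] or
    [0] at [1], and it is [0] exactly when [j > 1] is a part of [la], or when
    [j = 1] is a repeated part. Call such a [j] critical. Two critical indices
    make the derivative vanish; with a single one, the derivative is that of
    the critical factor alone. Having a single critical index [b > 1] means
    that [la] is [[b^a]] or [[b^a, 1]]; having only [1] as a critical index
    means that [la] is [[1^n]].

    The derivative of the factor of index [b > 1] and multiplicity [a] is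
    [M_b'(1) (-1)^(a-1) / a], the same number for [[b^a]] on [S_n] as for
    [[b^a, 1]] on [S_(n+1)]. This is why the two kinds of partitions are tied
    together by [star]: the rectangular part gives [[b^a]] the mass
    [rect_mass], and the identity
    [v la = rect_mass la + rect_mass (la minus one part 1)]
    ([splitting1_massE]) also holds on [[1^n]], where it reads
    [(-1)^n / (n (n-1)) = (-1)^(n-1) / n + (-1)^(n-2) / (n-1)].
    The support claims then reduce to [M_b'(1) <> 0], which follows from
    [M_b'(1) = \sum_(d | b) mu(d) / d = \prod_(p | b) (1 - 1/p)]
    ([necklace_slopeE]). That product formula, applied to the constant
    function [1] instead of [d |-> 1/d], also gives [M_b(1) = 0]
    for [b > 1].

    Uniqueness holds because the equation determines [w_(n+1)] from [w_n]; the
    recursion starts with [w_0 = 0], which is forced because [1] has no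
    almost-rectangular partition.

    A statement about masses of classes can be read as one about partitions
    only if each class is nonempty; [cycle_class_neq0] provides a permutation
    of any given cycle type. *)

(** * Cycle types *)

Lemma geq_total : total geq. Proof. by move=> m n; exact: leq_total. Qed.
Lemma geq_trans : transitive geq.
Proof. by move=> n m p nm pn; exact: leq_trans pn nm. Qed.
Lemma geq_antisym : antisymmetric geq.
Proof. by move=> m n; rewrite andbC => /anti_leq. Qed.

Lemma sorted_geq_perm_eq (la mu : seq nat) :
  sorted geq la -> sorted geq mu -> perm_eq la mu -> la = mu.
Proof. exact: (sorted_eq geq_trans geq_antisym). Qed.

Lemma sum_card_porbits (T : finType) (s : {perm T}) :
  (\sum_(X in porbits s) #|X|)%N = #|T|.
Proof.
rewrite -[RHS]sum1_card (partition_big_imset (porbit s)) /=.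
apply: eq_bigr => X /imsetP[x _ ->]; rewrite -sum1_card.
by apply: eq_bigl => y; rewrite eq_porbit_mem.
Qed.

Lemma cycle_type_partn (n : nat) (g : 'S_n) : is_partn n (cycle_type g).
Proof.
rewrite /is_partn /cycle_type sort_sorted; last exact: geq_total.
rewrite mem_sort (perm_sumn (permEl (perm_sort _ _))) /=; apply/andP; split.
  apply/imageP => -[X /imsetP[x _ ->]] /esym/eqP.
  by rewrite (negPf (card_porbit_neq0 g x)).
by rewrite /image_mem sumnE big_map big_enum /= sum_card_porbits card_ord.
Qed.

(** Conjugation by [h] only relabels points, so that it carries cycles to cycles. *)
Lemma porbitJ (T : finType) (g h : {perm T}) (x : T) :
  porbit (g ^ h)%g (h x) = h @: porbit g x.
Proof.
apply/setP => y; apply/porbitP/imsetP => [[i ->]|[z /porbitP[i ->] ->]].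
  exists ((g ^+ i)%g x); first exact: mem_porbit.
  by rewrite -conjXg permJ.
by exists i; rewrite -conjXg permJ.
Qed.

Lemma cycle_typeJ (n : nat) (g h : 'S_n) :
  cycle_type (g ^ h)%g = cycle_type g.
Proof.
have inj_h : injective (fun X : {set 'I_n} => h @: X).
  exact: imset_inj (@perm_inj _ h).
have porbitsJ : porbits (g ^ h)%g = [set h @: X | X : {set 'I_n} in porbits g].
  apply/setP => X; apply/imsetP/imsetP => [[x _ ->]|[_ /imsetP[x _ ->] ->]].
    exists (porbit g (h^-1 x)%g); first exact: imset_f.
    by rewrite -porbitJ permKV.
  by exists (h x) => //; rewrite porbitJ.
apply/perm_sortP; [exact: geq_total|exact: geq_trans|exact: geq_antisym|].
have eq_enum : perm_eq (enum (porbits (g ^ h)%g))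
    [seq h @: (X : {set 'I_n}) | X <- enum (porbits g)].
  apply: uniq_perm; rewrite ?enum_uniq ?(map_inj_uniq inj_h) ?enum_uniq //.
  move=> X; rewrite mem_enum porbitsJ.
  by apply/imsetP/mapP => -[Y gY ->]; exists Y; rewrite ?mem_enum // -mem_enum.
rewrite /image_mem (permPl (perm_map _ eq_enum)) -map_comp.
rewrite (eq_map (g := fun X : {set _} => #|X|)) ?perm_refl // => X.
by rewrite /= card_imset //; exact: perm_inj.
Qed.

(** A permutation of cycle type [la]: cut [0, ..., n-1] into consecutive
    intervals of lengths the parts of [la], and rotate each interval by one. A
    point is handled through its interval [block] and its position [pos] in
    it, which determine it. Rotations by an arbitrary [k] are introduced at
    once because they are the powers of the rotation by one. *)
Section RealizeCycleType.
Variables (n : nat) (la : seq nat).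
Hypothesis la_n : sumn la = n.

Let block (i : 'I_n) := reshape_index la i.
Let pos (i : 'I_n) := reshape_offset la i.
Let len (i : 'I_n) := nth 0%N la (block i).

Lemma pos_lt i : (pos i < len i)%N.
Proof. by apply: reshape_offsetP; rewrite la_n. Qed.

Lemma rotate_proof (k : nat) (i : 'I_n) :
  (flatten_index la (block i) ((pos i + k) %% len i) < n)%N.
Proof.
by rewrite -[X in (_ < X)%N]la_n flatten_indexP // ltn_pmod // (leq_trans _ (pos_lt i)).
Qed.

Definition rotate (k : nat) (i : 'I_n) : 'I_n := Ordinal (rotate_proof k i).

Lemma block_rotate k i : block (rotate k i) = block i.
Proof. by rewrite /block flatten_indexKl // ltn_pmod // (leq_trans _ (pos_lt i)). Qed.

Lemma pos_rotate k i : pos (rotate k i) = ((pos i + k) %% len i)%N.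
Proof. by rewrite /pos flatten_indexKr // ltn_pmod // (leq_trans _ (pos_lt i)). Qed.

Lemma block_pos_inj i j : block i = block j -> pos i = pos j -> i = j.
Proof.
move=> ij_block ij_pos; apply: val_inj; rewrite /= -[LHS](reshape_indexK la).
by rewrite -[RHS](reshape_indexK la) -/(block i) -/(pos i) ij_block ij_pos.
Qed.

Lemma rotateD k l i : rotate k (rotate l i) = rotate (l + k) i.
Proof.
apply: block_pos_inj; rewrite ?block_rotate // !pos_rotate.
by rewrite /len !block_rotate modnDml addnA.
Qed.

Lemma rotate_id k i : (len i %| k)%N -> rotate k i = i.
Proof.
move=> /dvdnP[q ->]; apply: block_pos_inj; rewrite ?block_rotate // pos_rotate.
by rewrite addnC modnMDl modn_small ?pos_lt.
Qed.

Lemma rotate_inj : injective (rotate 1).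
Proof.
move=> i j ij.
have eq_len : len i = len j by rewrite /len -(block_rotate 1) ij block_rotate.
have := congr1 (rotate (len i).-1) ij; rewrite !rotateD add1n.
rewrite prednK ?(leq_trans _ (pos_lt i)) // rotate_id // => ->.
by rewrite rotate_id // eq_len.
Qed.

Definition rotation : 'S_n := perm rotate_inj.

Lemma rotationX k i : (rotation ^+ k)%g i = rotate k i.
Proof.
elim: k => [|k IHk]; first by rewrite perm1 rotate_id.
by rewrite expgSr permM IHk permE rotateD addn1.
Qed.

Lemma porbit_rotation i : porbit rotation i = [set j | block j == block i].
Proof.
apply/setP => j; rewrite inE; apply/porbitP/eqP => [[k ->]|ji].
  by rewrite rotationX block_rotate.
exists (pos j + (len i - pos i))%N; rewrite rotationX.
apply: block_pos_inj; rewrite ?block_rotate // pos_rotate.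
rewrite addnCA subnKC ?(ltnW (pos_lt i)) // modnDr modn_small //.
by rewrite /len -ji pos_lt.
Qed.

Lemma card_block r : #|[set j | block j == r]| = nth 0%N la r.
Proof.
have bound (c : 'I_(nth 0%N la r)) : (flatten_index la r c < n)%N.
  by rewrite -[X in (_ < X)%N]la_n flatten_indexP.
have inj_c : injective (fun c => Ordinal (bound c)).
  move=> c d /(congr1 pos); rewrite /pos /= !flatten_indexKr //.
  exact: val_inj.
rewrite -[RHS]card_ord -(card_imset _ inj_c); apply/eq_card => j.
rewrite inE; apply/eqP/imsetP => [jr|[c _ ->]]; last first.
  by rewrite /block flatten_indexKl.
have lt_j : (pos j < nth 0%N la r)%N by rewrite -jr pos_lt.
exists (Ordinal lt_j) => //; apply: val_inj => /=.
by rewrite -jr reshape_indexK.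
Qed.

Lemma cycle_type_rotation :
  sorted geq la -> 0%N \notin la -> cycle_type rotation = la.
Proof.
move=> la_sorted la_pos.
pose B (r : nat) := [set j | block j == r].
have B_len r : (r < size la)%N -> (0 < #|B r|)%N.
  move=> lt_r; rewrite card_block lt0n; apply: contra la_pos => /eqP <-.
  exact: mem_nth.
have enumB : perm_eq (enum (porbits rotation)) [seq B r | r <- iota 0 (size la)].
  apply: uniq_perm; rewrite ?enum_uniq //.
    rewrite map_inj_in_uniq ?iota_uniq // => r r'.
    rewrite !mem_iota !add0n /= => lt_r lt_r' eqB.
    have /card_gt0P[j jr] := B_len r lt_r.
    have := jr; rewrite eqB; move: jr; rewrite !inE => /eqP -> /eqP.
    by [].
  move=> X; rewrite mem_enum; apply/imsetP/mapP => [[i _ ->]|[r]].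
    exists (block i); last by rewrite porbit_rotation.
    by rewrite mem_iota add0n /= reshape_indexP // la_n.
  rewrite mem_iota add0n /= => lt_r ->.
  have /card_gt0P[j] := B_len r lt_r; rewrite inE => /eqP jr.
  by exists j => //; rewrite porbit_rotation jr.
apply: sorted_geq_perm_eq => //; first by apply: sort_sorted; exact: geq_total.
rewrite /cycle_type (permPl (permEl (perm_sort _ _))).
rewrite /image_mem (permPl (perm_map _ enumB)) -map_comp.
rewrite (eq_map (g := nth 0%N la)); last by move=> r /=; rewrite card_block.
by rewrite map_nth_iota0 // take_size.
Qed.

End RealizeCycleType.

(** Without this lemma a partition could have mass [0] for lack of permutations. *)
Lemma cycle_class_neq0 (n : nat) (la : seq nat) :
  is_partn n la -> cycle_class n la != set0.
Proof.
move=> /and3P[la_sorted la_pos /eqP la_n]; apply/set0Pn.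
by exists (rotation la_n); rewrite inE cycle_type_rotation.
Qed.

(** * Sums of completely multiplicative functions against the Moebius function *)

Lemma primes_Mprime (p d : nat) : prime p -> (0 < d)%N -> ~~ (p %| d)%N ->
  perm_eq (primes (p * d)) (p :: primes d).
Proof.
move=> p_pr d_gt0 pNd.
apply: uniq_perm; rewrite ?primes_uniq //= ?primes_uniq ?andbT.
  by rewrite mem_primes p_pr d_gt0 /= pNd.
move=> q; rewrite inE primesM ?(prime_gt0 p_pr) //.
by rewrite (primes_prime p_pr) mem_seq1.
Qed.

Lemma mobius_Mprime (p d : nat) : prime p -> (0 < d)%N -> ~~ (p %| d)%N ->
  mobius (p * d) = - mobius d.
Proof.
move=> p_pr d_gt0 pNd; have pd := primes_Mprime p_pr d_gt0 pNd.
rewrite /mobius (perm_all _ pd) (perm_size pd) /=.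
have -> : logn p (p * d) = 1%N.
  by rewrite lognM ?(prime_gt0 p_pr) // logn_prime // eqxx lognE (negPf pNd) !andbF.
rewrite /= (eq_in_all (a2 := fun q => logn q d == 1%N)); last first.
  move=> q; rewrite mem_primes => /and3P[q_pr _ qd].
  rewrite lognM ?(prime_gt0 p_pr) // logn_prime //; case: (eqVneq q p) => // qp.
  by rewrite -qp qd in pNd.
by case: ifP; rewrite ?oppr0 // exprS mulN1r.
Qed.

Lemma mobius_Mprime_dvd (p d : nat) : prime p -> (0 < d)%N -> (p %| d)%N ->
  mobius (p * d) = 0.
Proof.
move=> p_pr d_gt0 pd; rewrite /mobius ifN //; apply/allPn; exists p.
  by rewrite mem_primes p_pr muln_gt0 d_gt0 prime_gt0 ?dvdn_mulr.
rewrite lognM ?(prime_gt0 p_pr) // logn_prime // eqxx.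
by have: (0 < logn p d)%N; [rewrite logn_gt0 mem_primes p_pr d_gt0 | case: (logn p d)].
Qed.

(** Choose a prime [p] dividing [m] and write [m = m' p^l] with [m'] prime to
    [p]. The divisors of [m] prime to [p] are those of [m'], the divisors [p d]
    with [d] a divisor of [m'] contribute the same sum times [- g p], and the
    remaining ones, which are multiples of [p ^ 2], contribute [0]. Hence each
    prime splits off a factor [1 - g p]. *)
Lemma sum_mobius_mul (R : comNzRingType) (g : nat -> R) (m : nat) :
  g 1%N = 1 -> (forall p d, g (p * d)%N = g p * g d) -> (0 < m)%N ->
  \sum_(d <- divisors m) (mobius d)%:~R * g d =
  \prod_(p <- primes m) (1 - g p).
Proof.
move=> g1 gM; elim/ltn_ind: m => m IHm m_gt0.
case: (ltngtP m 1) => [|m_gt1|->]; first by rewrite ltnNge m_gt0.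
- have p_pr := pdiv_prime m_gt1; set p := pdiv m in p_pr.
  have [m' p_m' def_m] := pfactor_coprime p_pr m_gt0.
  have pNm' : ~~ (p %| m')%N by rewrite -prime_coprime.
  have pm : (p %| m)%N by exact: pdiv_dvd.
  have m'_gt0 : (0 < m')%N by move: m_gt0; rewrite def_m muln_gt0 => /andP[].
  have p_gt0 := prime_gt0 p_pr.
  have [k def_k] : exists k, logn p m = k.+1.
    by exists (logn p m).-1; rewrite prednK // logn_gt0 mem_primes p_pr m_gt0.
  rewrite def_k in def_m.
  have lt_m' : (m' < m)%N
    by rewrite def_m -{1}(muln1 m') ltn_pmul2l // -(exp1n k.+1) ltn_exp2r ?prime_gt1.
  have mp_gt0 : (0 < m %/ p)%N by rewrite divn_gt0 // dvdn_leq.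
  (* Needed both for [N = m] and for [N = m / p]. *)
  have coprime_part l N : (0 < N)%N -> N = (m' * p ^ l)%N ->
      perm_eq [seq d <- divisors N | ~~ (p %| d)%N] (divisors m').
    move=> N_gt0 def_N; apply: uniq_perm; rewrite ?filter_uniq ?divisors_uniq // => d.
    rewrite mem_filter -!dvdn_divisors // def_N; apply/andP/idP => [[pNd]|dm'].
      by rewrite Gauss_dvdl // coprime_sym coprimeXl // prime_coprime.
    by split; [apply: contra pNm' => /dvdn_trans->|exact: dvdn_mulr].
  have multiple_part : perm_eq [seq d <- divisors m | (p %| d)%N]
      [seq (p * e)%N | e <- divisors (m %/ p)].
    apply: uniq_perm; rewrite ?filter_uniq ?divisors_uniq //.
      rewrite map_inj_uniq ?divisors_uniq // => d e /eqP.
      by rewrite eqn_pmul2l // => /eqP.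
    move=> d; rewrite mem_filter -dvdn_divisors //.
    apply/andP/mapP => [[/dvdnP[e ->] em]|[e]].
      exists e; last by rewrite mulnC.
      by rewrite -dvdn_divisors // dvdn_divRL.
    rewrite -dvdn_divisors // => em ->; rewrite dvdn_mulr //; split=> //.
    by rewrite mulnC -dvdn_divRL.
  have def_mp : (m %/ p = m' * p ^ k)%N by rewrite def_m expnSr mulnA mulnK.
  rewrite (bigID (fun d => ~~ (p %| d)%N)) /= -[X in X + _]big_filter.
  rewrite (perm_big _ (coprime_part _ _ m_gt0 def_m)) /=.
  rewrite [X in _ + X](eq_bigl (fun d => (p %| d)%N)); last by move=> d; rewrite negbK.
  rewrite -[X in _ + X]big_filter (perm_big _ multiple_part) /= big_map.
  rewrite [X in _ + X](bigID (fun d => ~~ (p %| d)%N)) /=.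
  rewrite [X in _ + (_ + X)]big_seq_cond [X in _ + (_ + X)]big1 ?addr0; last first.
    move=> d; rewrite negbK -dvdn_divisors // => /andP[dm pd].
    by rewrite mobius_Mprime_dvd ?mul0r // (dvdn_gt0 mp_gt0).
  rewrite [X in _ + X]big_seq_cond.
  rewrite [X in _ + X](eq_bigr (fun d => - g p * ((mobius d)%:~R * g d))); last first.
    move=> d; rewrite -dvdn_divisors // => /andP[dm pNd].
    rewrite mobius_Mprime ?(dvdn_gt0 mp_gt0) // gM intrN.
    by rewrite !mulNr mulrCA.
  rewrite -[X in _ + X]big_seq_cond -[X in _ + X]big_filter.
  rewrite (perm_big _ (coprime_part _ _ mp_gt0 def_mp)) /=.
  rewrite -mulr_sumr -[X in X + _]mul1r -mulrDl IHm //.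
  have mE : perm_eq (primes m) (p :: primes m').
    rewrite -(permPr (primes_Mprime p_pr m'_gt0 pNm')).
    apply: uniq_perm; rewrite ?primes_uniq // => q.
    by rewrite def_m !primesM ?expn_gt0 ?p_gt0 // primesX // orbC.
  by rewrite (perm_big _ mE) big_cons.
- by rewrite /= big_nil big_seq1 g1 mulr1.
Qed.

(** * Necklace and binomial polynomials at 1 *)

Section NecklaceAndBinomial.
Variable R : realFieldType.
Implicit Types (t : {poly R}) (x : R).

Lemma horner_divp_XsubC (p : {poly R}) x : p.[x] = 0 ->
  (p %/ ('X - x%:P)).[x] = p^`().[x].
Proof.
move=> /rootP; rewrite -dvdp_XsubCl => /divpK {2}<-.
by rewrite derivM derivXsubC mulr1 !hornerE /= subrr mulr0 add0r.
Qed.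

Lemma horner_prod_root (I : eqType) (r : seq I) (F : I -> {poly R}) x i :
  i \in r -> (F i).[x] = 0 -> (\prod_(j <- r) F j).[x] = 0.
Proof.
by move=> ri Fi0; rewrite (big_rem i) //= hornerM Fi0 mul0r.
Qed.

(** All terms of the Leibniz rule but one contain the vanishing factor [F i]. *)
Lemma deriv_prod_root (I : eqType) (r : seq I) (F : I -> {poly R}) x i :
  uniq r -> i \in r -> (F i).[x] = 0 ->
  (\prod_(j <- r) F j)^`().[x] =
  (F i)^`().[x] * \prod_(j <- r | j != i) (F j).[x].
Proof.
move=> Ur ri Fi0.
by rewrite (bigD1_seq i) //= derivM hornerD !hornerM Fi0 mul0r addr0 horner_prod.
Qed.

Lemma binom_poly0 t : binom_poly t 0 = 1.
Proof. by rewrite /binom_poly big_ord0 fact0 invr1 scale1r. Qed.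

Lemma prod_negS n : \prod_(i < n) (0 - i.+1%:R) = (-1) ^+ n * n`!%:R :> R.
Proof.
elim: n => [|n IHn]; first by rewrite big_ord0 mulr1.
rewrite big_ord_recr /= IHn sub0r exprS factS natrM.
by rewrite mulrN mulN1r mulNr -!mulrA [_ * n.+1%:R]mulrC.
Qed.

Lemma binom_poly_root t k x : t.[x] = 0 -> (0 < k)%N ->
  (binom_poly t k).[x] = 0.
Proof.
case: k => // k t0 _; rewrite hornerZ big_ord_recl /= subr0 hornerM t0.
by rewrite mul0r mulr0.
Qed.

Lemma deriv_binom_poly_root t k x : t.[x] = 0 -> (0 < k)%N ->
  (binom_poly t k)^`().[x] = t^`().[x] * ((-1) ^+ k.-1 / k%:R).
Proof.
case: k => // k t0 _; rewrite derivZ hornerZ big_ord_recl /= subr0.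
rewrite derivM hornerD !hornerM t0 mul0r addr0 horner_prod.
rewrite (eq_bigr (fun i : 'I_k => 0 - i.+1%:R)); last first.
  by move=> i _; rewrite hornerD hornerN t0 -polyC_natr hornerC.
rewrite prod_negS mulrCA; congr (_ * _).
rewrite factS natrM invfM mulrCA divfK // pnatr_eq0 -lt0n.
exact: fact_gt0.
Qed.

(** The root [1] of [X (X - 1) ... (X - k + 1)] comes from its second factor. *)
Lemma binom_polyX_horner1 k : (binom_poly ('X : {poly R}) k).[1] = (k <= 1)%:R.
Proof.
case: k => [|[|k]]; first by rewrite binom_poly0 hornerC.
  by rewrite hornerZ big_ord1 subr0 hornerX mulr1 (_ : 1`! = 1)%N // invr1.
rewrite hornerZ !big_ord_recl /= !hornerM.
have -> : ('X - (bump 0 0)%:R : {poly R}).[1] = 0.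
  by rewrite hornerD hornerN hornerX -polyC_natr hornerC subrr.
by rewrite !(mul0r, mulr0).
Qed.

Lemma deriv_binom_polyX_horner1 k : (1 < k)%N ->
  (binom_poly ('X : {poly R}) k)^`().[1] = (-1) ^+ k / (k * k.-1)%:R.
Proof.
case: k => [|[|k]] // _; rewrite derivZ hornerZ !big_ord_recl /= subr0.
rewrite mulrCA derivM hornerD [X in _ + X]hornerM.
have -> : ('X - (bump 0 0)%:R : {poly R}).[1] = 0.
  by rewrite hornerD hornerN hornerX -polyC_natr hornerC subrr.
rewrite mul0r addr0 -polyC_natr derivXsubC mul1r hornerM hornerX mul1r horner_prod.
rewrite (eq_bigr (fun i : 'I_k => 0 - i.+1%:R)); last first.
  move=> i _; rewrite hornerD hornerN hornerX -polyC_natr hornerC.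
  rewrite /bump /= !add1n -[i.+2%:R]natr1.
  by rewrite opprD addrCA subrr addr0 sub0r.
rewrite prod_negS mulrCA !exprS !mulN1r opprK; congr (_ * _).
by rewrite !factS mulnA natrM invfM divfK // pnatr_eq0 -lt0n fact_gt0.
Qed.

Lemma necklace_horner1 m : (1 < m)%N -> (necklace_poly R m).[1] = 0.
Proof.
move=> m_gt1; rewrite hornerZ horner_sum.
rewrite (eq_bigr (fun d => (mobius d)%:~R * 1)); last first.
  by move=> d _; rewrite hornerZ hornerXn expr1n.
rewrite sum_mobius_mul ?(ltnW m_gt1) // => [|p d]; last by rewrite mulr1.
have [p ps] : exists p : nat, p \in primes m.
  by exists (pdiv m); rewrite mem_primes pdiv_prime // pdiv_dvd (ltnW m_gt1).
by rewrite (big_rem p) //= subrr mul0r mulr0.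
Qed.

Lemma necklace_poly1 : necklace_poly R 1 = 'X.
Proof. by rewrite /necklace_poly big_seq1 invr1 !scale1r. Qed.

(** For [m > 0] this is [phi m / m], with [phi] the Euler totient. *)
Definition necklace_slope m : R := (necklace_poly R m)^`().[1].

Lemma necklace_slopeE m : (0 < m)%N ->
  necklace_slope m = \prod_(p <- primes m) (1 - p%:R^-1).
Proof.
move=> m_gt0.
rewrite -(sum_mobius_mul (g := fun d : nat => d%:R^-1)) ?invr1 //; last first.
  by move=> p d; rewrite natrM invfM.
rewrite /necklace_slope derivZ hornerZ raddf_sum /= horner_sum mulr_sumr.
rewrite big_seq [RHS]big_seq; apply: eq_bigr => d; rewrite -dvdn_divisors // => dm.
rewrite [in LHS]derivZ hornerZ derivXn hornerMn hornerXn expr1n natf_div //.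
rewrite mulrCA; congr (_ * _).
by rewrite mulrA mulVf ?mul1r // pnatr_eq0 -lt0n.
Qed.

Lemma necklace_slope_neq0 m : (0 < m)%N -> necklace_slope m != 0.
Proof.
move=> m_gt0; rewrite necklace_slopeE // prodf_seq_neq0; apply/allP => p.
rewrite mem_primes => /andP[/prime_gt1 p_gt1 _] /=.
by rewrite subr_eq0 eq_sym invr_eq1 pnatr_eq1 neq_ltn p_gt1 orbT.
Qed.

Lemma necklace_slope1 : necklace_slope 1 = 1.
Proof. by rewrite /necklace_slope necklace_poly1 derivX hornerC. Qed.

End NecklaceAndBinomial.

(** * Partitions *)

Lemma part_bounds n la j : is_partn n la -> j \in la -> (0 < j <= n)%N.
Proof.
move=> /and3P[_ la0 /eqP <-] laj; rewrite lt0n; apply/andP; split.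
  by apply: contra la0 => /eqP <-.
by rewrite (perm_sumn (perm_to_rem laj)) leq_addr.
Qed.

Lemma partn_rem1 n la : is_partn n.+1 la -> 1%N \in la -> is_partn n (rem 1%N la).
Proof.
move=> /and3P[la_sorted la0 /eqP la_n] la1; apply/and3P; split.
- exact: (subseq_sorted geq_trans (rem_subseq _ _) la_sorted).
- by apply: contra la0 => /mem_rem.
- by move: la_n; rewrite (perm_sumn (perm_to_rem la1)) /= add1n => /succn_inj/eqP.
Qed.

Lemma partn_ones n : is_partn n (nseq n 1%N).
Proof.
rewrite /is_partn sumn_nseq mul1n eqxx mem_nseq andbF andbT /=.
by elim: n => // -[|n].
Qed.

(** Parts are at least [1], so that in a nonincreasing sequence a [1] comes last. *)
Lemma partn_rcons_rem1 n la c d : is_partn n la -> 1%N \in la ->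
  rem 1%N la = nseq c d -> la = rcons (nseq c d) 1%N.
Proof.
move=> la_n la1 rem_la; have := perm_to_rem la1; rewrite rem_la => la_perm.
case/and3P: (la_n) => la_sorted _ _.
apply: sorted_geq_perm_eq => //; last by rewrite perm_sym perm_rcons perm_sym.
have [->|c_gt0] := posnP c; first by [].
have laD : d \in la by rewrite (perm_mem la_perm) inE mem_nseq c_gt0 eqxx orbT.
have /andP[d_gt0 _] := part_bounds la_n laD.
elim: {la_perm laD rem_la}c c_gt0 => // -[|c] IHc _ /=; first by rewrite d_gt0.
by rewrite leqnn /=; apply: IHc.
Qed.

(** * The masses of the classes *)

Section Masses.
Variable R : realFieldType.
Implicit Types (la : seq nat) (n : nat).
Local Notation necklace_slope := (necklace_slope R).
Local Notation necklace_poly := (necklace_poly R).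

(** The mass given by the rectangular part to the class of [[b^a]]. Nonconstant
    sequences get [0]; so does the empty one, as its size has inverse [0]. *)
Definition rect_mass la : R :=
  if constant la then
    necklace_slope (head 1%N la) * ((-1) ^+ (size la).-1 / (size la)%:R)
  else 0.

Definition almost_rect_mass la : R :=
  if 1%N \in la then rect_mass (rem 1%N la) else 0.

Lemma rect_mass_nseq a b : (0 < a)%N ->
  rect_mass (nseq a b) = necklace_slope b * ((-1) ^+ a.-1 / a%:R).
Proof.
by case: a => // a _; rewrite /rect_mass constant_nseq size_nseq.
Qed.

Lemma rect_mass_nil : rect_mass [::] = 0.
Proof. by rewrite /rect_mass /= invr0 !mulr0. Qed.

Lemma rect_mass_nonconstant la b c :
  b \in la -> c \in la -> b != c -> rect_mass la = 0.
Proof.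
move=> lab lac bc; rewrite /rect_mass ifN //; apply/negP => /(constantP 0%N)[d la_d].
move: lab lac; rewrite la_d !mem_nseq => /andP[_ /eqP bd] /andP[_ /eqP cd].
by rewrite bd cd eqxx in bc.
Qed.

Lemma rect_mass_nseq_neq0 a b : (0 < a)%N -> (0 < b)%N ->
  rect_mass (nseq a b) != 0.
Proof.
move=> a_gt0 b_gt0; rewrite rect_mass_nseq // !mulf_neq0 ?necklace_slope_neq0 //.
  by rewrite signr_eq0.
by rewrite invr_eq0 pnatr_eq0 -lt0n.
Qed.

Lemma rect_mass_neq0 la : 0%N \notin la -> rect_mass la != 0 ->
  exists a b, [/\ (0 < a)%N, (0 < b)%N & la = nseq a b].
Proof.
move=> la0; rewrite /rect_mass.
case: (constantP 0%N) => [[b la_b]|]; last by rewrite eqxx.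
case la_nil: la => [|c s]; first by rewrite /= invr0 !mulr0 eqxx.
move=> _; exists (size la), b; rewrite -la_nil; split=> //; first by rewrite la_nil.
by rewrite lt0n; apply: contra la0 => /eqP <-; rewrite la_b mem_nseq la_nil /= eqxx.
Qed.

Definition cycle_factor la j : {poly R} :=
  binom_poly (necklace_poly j) (count_mem j la).

(** The index [j] is critical when its factor vanishes at [1]: from
    multiplicity [1] on for [j > 1], but only from [2] on for [j = 1], because
    [binom(X, 1) = X] is [1] there. *)
Definition critical la j : bool := ((j == 1) < count_mem j la)%N.

Lemma cycle_factor_horner1 la j : (0 < j)%N ->
  (cycle_factor la j).[1] = (~~ critical la j)%:R.
Proof.
rewrite /cycle_factor /critical; case: (ltngtP j 1) => [|j_gt1 _|-> _].
- by case: j.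
- have [->|cj] := posnP; first by rewrite binom_poly0 hornerC.
  by rewrite binom_poly_root // necklace_horner1.
by rewrite necklace_poly1 binom_polyX_horner1 -leqNgt.
Qed.

Lemma splitting1_massE_critical n la j : (1 < n)%N -> (0 < j <= n)%N ->
  critical la j -> splitting1_mass R n la =
  (cycle_factor la j)^`().[1] *
  \prod_(1 <= i < n.+1 | i != j) (cycle_factor la i).[1].
Proof.
move=> n_gt1 /andP[j_gt0 j_n] crit_j; rewrite /splitting1_mass ifN; last first.
  by rewrite neq_ltn n_gt1 orbT.
have fj0 : (cycle_factor la j).[1] = 0 by rewrite cycle_factor_horner1 // crit_j.
have jn : j \in index_iota 1 n.+1 by rewrite mem_index_iota j_gt0.
rewrite hornerXn expr1n divr1 -polyC1 horner_divp_XsubC.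
  by rewrite (deriv_prod_root (iota_uniq _ _) jn fj0).
exact: horner_prod_root jn fj0.
Qed.

Lemma splitting1_mass_critical2 n la i j : (1 < n)%N ->
  (0 < i <= n)%N -> (0 < j <= n)%N -> i != j -> critical la i -> critical la j ->
  splitting1_mass R n la = 0.
Proof.
move=> n_gt1 i_n j_n ij crit_i crit_j.
rewrite (splitting1_massE_critical n_gt1 j_n crit_j).
have in_i : i \in index_iota 1 n.+1 by rewrite mem_index_iota.
rewrite (big_rem i) //= ij cycle_factor_horner1 ?crit_i; last by case/andP: i_n.
by rewrite mul0r mulr0.
Qed.

Lemma splitting1_mass_critical1 n la j : (1 < n)%N -> (0 < j <= n)%N ->
  critical la j -> (forall i, i != j -> ~~ critical la i) ->
  splitting1_mass R n la = (cycle_factor la j)^`().[1].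
Proof.
move=> n_gt1 j_n crit_j crit1.
rewrite (splitting1_massE_critical n_gt1 j_n crit_j) big_seq_cond big1 ?mulr1 // => i.
rewrite mem_index_iota => /andP[/andP[i_gt0 _] ij].
by rewrite cycle_factor_horner1 // crit1.
Qed.

Lemma splitting1_mass_ones n : (1 < n)%N ->
  splitting1_mass R n (nseq n 1%N) = (-1) ^+ n / (n * n.-1)%:R.
Proof.
move=> n_gt1; have count1 : count_mem 1%N (nseq n 1%N) = n.
  by rewrite count_nseq /= mul1n.
rewrite (@splitting1_mass_critical1 _ _ 1%N) // ?(ltnW n_gt1) //.
- by rewrite /cycle_factor count1 necklace_poly1 deriv_binom_polyX_horner1.
- by rewrite /critical count1.
by move=> i i1; rewrite /critical count_nseq /= [_ == i]eq_sym (negPf i1).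
Qed.

(** With no part [b > 1] the partition is [[1^n]] and the formula is a
    computation. Otherwise a second critical index, either another part [c > 1]
    or a repeated [1], makes all three terms vanish: two distinct values remain
    among the parts even after a part [1] is removed. If [b] is the only
    critical index, then the parts are all [b] but for at most one [1], and
    exactly one of the two terms on the right is nonzero, according to whether
    [1] is a part. *)
Lemma splitting1_massE n la : (0 < n)%N -> is_partn n la ->
  splitting1_mass R n la = rect_mass la + almost_rect_mass la.
Proof.
move=> n_gt0 la_n; rewrite /almost_rect_mass.
have [/hasP[b lab b1]|all1] := boolP (has (fun j => j != 1%N) la); last first.
  have la_ones : la = nseq n 1%N.
    have /all_pred1P la_1 : all (pred1 1%N) la.
      by apply/allP => j laj; apply: contraR all1 => j1; apply/hasP; exists j.
    case/and3P: la_n => _ _ /eqP <-.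
    by rewrite {1 2}la_1 sumn_nseq mul1n.
  rewrite la_ones mem_nseq eqxx n_gt0 /=.
  case: n n_gt0 {la_n la_ones} => [//|[|n]] _.
    (* For [n = 1] the mass is [1] by convention. *)
    rewrite /splitting1_mass /= rect_mass_nil addr0.
    by rewrite (rect_mass_nseq (a := 1)) // necklace_slope1 divr1 mulr1.
  rewrite splitting1_mass_ones //=.
  rewrite (rect_mass_nseq (a := n.+2)) // (rect_mass_nseq (a := n.+1)) //.
  rewrite necklace_slope1 !mul1r /= natrM -[n.+2%:R]natr1 !exprS !mulN1r opprK.
  have n1 : n.+1%:R != 0 :> R by rewrite pnatr_eq0.
  have n2 : n.+1%:R + 1 != 0 :> R by rewrite natr1 pnatr_eq0.
  (* Generalizing keeps [field] from expanding the numeral [n.+1%:R]. *)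
  move: ((-1) ^+ n) (n.+1%:R : R) n1 n2 => s x x0 x1.
  by field; rewrite x0 x1.
have b_n := part_bounds la_n lab.
have n_gt1 : (1 < n)%N.
  case/andP: b_n => b_gt0; apply: leq_trans.
  by rewrite ltn_neqAle eq_sym b1.
have count_b : (0 < count_mem b la)%N by rewrite -has_count has_pred1.
have crit_b : critical la b by rewrite /critical (negPf b1).
have rem_b : b \in rem 1%N la by exact: rem_mem.
have [/hasP[c lac /andP[c1 cb]]|all1b] :=
  boolP (has (fun j => (j != 1%N) && (j != b)) la).
  have crit_c : critical la c by rewrite /critical (negPf c1) -has_count has_pred1.
  have c_n := part_bounds la_n lac.
  rewrite (splitting1_mass_critical2 n_gt1 c_n b_n cb crit_c crit_b).
  rewrite (rect_mass_nonconstant lac lab cb) add0r.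
  by rewrite (rect_mass_nonconstant (rem_mem c1 lac) rem_b cb) if_same.
have parts j : j \in la -> (j == 1%N) || (j == b).
  by move=> laj; apply: contraR all1b; rewrite negb_or => j1b; apply/hasP; exists j.
have [crit_1|ncrit_1] := boolP (critical la 1%N).
  have la1 : 1%N \in la by rewrite -has_pred1 has_count (leq_trans _ crit_1).
  have rem1 : 1%N \in rem 1%N la.
    by rewrite -has_pred1 has_count count_rem la1 subn_gt0.
  have one_n : (1 <= 1 <= n)%N by [].
  rewrite (splitting1_mass_critical2 n_gt1 one_n b_n _ crit_1 crit_b) 1?eq_sym //.
  rewrite (rect_mass_nonconstant lab la1 b1) add0r.
  by rewrite (rect_mass_nonconstant rem_b rem1 b1) if_same.
rewrite (splitting1_mass_critical1 n_gt1 b_n crit_b); last first.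
  move=> i ib; have [->//|i1] := eqVneq i 1%N.
  rewrite /critical (negPf i1) -has_count has_pred1.
  by apply/negP => /parts; rewrite (negPf i1) (negPf ib).
have b_gt1 : (1 < b)%N by rewrite ltn_neqAle eq_sym b1; case/andP: b_n.
rewrite /cycle_factor deriv_binom_poly_root ?necklace_horner1 //.
rewrite -/(necklace_slope b); case: ifP => la1.
  have rem_nseq : rem 1%N la = nseq (count_mem b la) b.
    have /all_pred1P rem_la : all (pred1 b) (rem 1%N la).
      apply/allP => j rem_j; have := parts _ (mem_rem rem_j).
      have [j1|//] := eqVneq j 1%N.
      move: ncrit_1; rewrite /critical -leqNgt => /(leq_sub2r 1).
      have := count_rem 1%N (pred1 1%N) la; rewrite la1 /= => <-.
      by rewrite leqn0 => /eqP /count_memPn; rewrite -{1}j1 rem_j.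
    have := count_rem 1%N (pred1 b) la; rewrite la1 /= eq_sym (negPf b1) subn0 => <-.
    by rewrite rem_la count_nseq /= eqxx mul1n.
  by rewrite (rect_mass_nonconstant lab la1 b1) add0r rem_nseq rect_mass_nseq.
have la_nseq : la = nseq (count_mem b la) b.
  have /all_pred1P la_b : all (pred1 b) la.
    by apply/allP => j laj; have /orP[/eqP j1|//] := parts j laj; rewrite -j1 laj in la1.
  by rewrite {1}la_b {2}la_b count_nseq /= eqxx mul1n.
by rewrite addr0 [in RHS]la_nseq rect_mass_nseq.
Qed.

(** * The decomposition *)

Lemma mass_class n (v : seq nat -> R) la : is_partn n la ->
  mass (class_measure n v) (cycle_class n la) = v la.
Proof. by move=> la_n; rewrite mass_class_measure // cycle_class_neq0. Qed.

Definition rect_part n : {ffun 'S_n -> R} := class_measure n rect_mass.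

Lemma mass_star n la : is_partn n.+1 la ->
  mass (star (rect_part n)) (cycle_class n.+1 la) = almost_rect_mass la.
Proof.
move=> la_n; rewrite mass_class // /almost_rect_mass; case: ifP => // la1.
by rewrite mass_class // partn_rem1.
Qed.

Lemma mass_splitting1 n la : (0 < n)%N -> is_partn n la ->
  mass (splitting1 R n) (cycle_class n la) = rect_mass la + almost_rect_mass la.
Proof. by move=> n_gt0 la_n; rewrite mass_class // (splitting1_massE n_gt0 la_n). Qed.

Lemma rect_mass_rectangular n la : is_partn n la -> rect_mass la != 0 ->
  rectangular n la.
Proof.
case/and3P=> _ la0 /eqP la_n /(rect_mass_neq0 la0)[a [b [a_gt0 b_gt0 la_ab]]].
by exists a, b; split=> //; rewrite -la_n la_ab sumn_nseq mulnC.
Qed.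

Lemma almost_rect_mass_rectangular n la : is_partn n.+1 la ->
  almost_rect_mass la != 0 -> almost_rectangular n.+1 la.
Proof.
move=> la_n; rewrite /almost_rect_mass; case: ifP => [la1|_]; last by rewrite eqxx.
have rem_n := partn_rem1 la_n la1.
move=> /(rect_mass_rectangular rem_n)[c [d [c_gt0 d_gt0 cd_n rem_cd]]].
by exists c, d; split; rewrite ?cd_n // (partn_rcons_rem1 la_n la1 rem_cd).
Qed.

Lemma rem1_rcons_nseq c d : rem 1%N (rcons (nseq c d) 1%N) = nseq c d.
Proof.
elim: c => [|c IHc] //=; case: eqP => [->|_]; last by rewrite IHc.
by elim: c {IHc} => //= c ->.
Qed.

Lemma splitting1_ones_neq0 n : (0 < n)%N -> splitting1_mass R n (nseq n 1%N) != 0.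
Proof.
case: n => // -[|n] _; first by rewrite /splitting1_mass oner_eq0.
by rewrite splitting1_mass_ones // mulf_neq0 ?signr_eq0 // invr_eq0 pnatr_eq0.
Qed.

Lemma splitting1_support n la : (0 < n)%N -> is_partn n la ->
  charges (splitting1 R n) la <-> rectangular n la \/ almost_rectangular n la.
Proof.
case: n => // n _ la_n; rewrite /charges; split.
  rewrite mass_splitting1 //.
  have [-> rect_la|rect_la _] := eqVneq (almost_rect_mass la) 0.
    by left; apply: rect_mass_rectangular; rewrite // addr0 in rect_la.
  by right; apply: almost_rect_mass_rectangular.
(* Here both terms are nonzero with opposite signs, so [splitting1_massE] does not
   directly show that their sum is nonzero. *)
have ones : la = nseq n.+1 1%N ->
    mass (splitting1 R n.+1) (cycle_class n.+1 la) != 0.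
  by move=> la1; rewrite mass_class // la1 splitting1_ones_neq0.
case=> [[a [b [a_gt0 b_gt0 ab_n la_ab]]]|[c [d [c_gt0 d_gt0 cd_n la_cd]]]].
  have [b1|b1] := eqVneq b 1%N.
    by apply: ones; rewrite la_ab b1 -ab_n b1 muln1.
  rewrite mass_splitting1 // /almost_rect_mass {2}la_ab mem_nseq.
  rewrite [1%N == b]eq_sym (negPf b1) andbF addr0 la_ab.
  exact: rect_mass_nseq_neq0.
have [d1|d1] := eqVneq d 1%N.
  by apply: ones; rewrite la_cd -cd_n d1 muln1 -cats1 -(nseqD c 1) addn1.
have la1 : 1%N \in la by rewrite la_cd mem_rcons mem_head.
have lad : d \in la by rewrite la_cd mem_rcons inE mem_nseq c_gt0 eqxx orbT.
rewrite mass_splitting1 // /almost_rect_mass la1 (rect_mass_nonconstant lad la1 d1).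
by rewrite add0r la_cd rem1_rcons_nseq rect_mass_nseq_neq0.
Qed.

Lemma rect_part_decomposition : splitting1_decomposition rect_part.
Proof.
split=> [n g h|n]; first by rewrite !ffunE cycle_typeJ.
split.
- apply/ffunP => g; rewrite !ffunE -mulrDl; congr (_ / _).
  rewrite (splitting1_massE _ (cycle_type_partn g)) //; congr (_ + _).
  rewrite /almost_rect_mass; case: ifP => // g1.
  by rewrite mass_class // partn_rem1 //; exact: cycle_type_partn.
- move=> la la_n; rewrite /charges mass_class //; exact: rect_mass_rectangular.
- move=> la la_n; rewrite /charges mass_star //; exact: almost_rect_mass_rectangular.
Qed.

(** The equation at [n] recovers the component on [S_(n+1)] from that on [S_n],
    so only [w_0] is in question. At [n = 0] the support condition on [star]
    leaves no partition, while [star] copies the mass of [w_0] to [[1]]; as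
    [S_0] is trivial, [w_0] vanishes. *)
Lemma decomposition_unique (w w' : forall n, {ffun 'S_n -> R}) :
  splitting1_decomposition w -> splitting1_decomposition w' ->
  forall n, w' n = w n.
Proof.
have w0 (u : forall n, {ffun 'S_n -> R}) : splitting1_decomposition u -> u 0%N = 0.
  case=> _ /(_ 0%N)[_ _ supp]; have p1 := partn_ones 1.
  have no_almost : ~ almost_rectangular 1 [:: 1%N].
    by case=> c [d [c_gt0 d_gt0 /succn_inj/eqP]]; rewrite eqn0Ngt muln_gt0 c_gt0 d_gt0.
  have : mass (star (u 0%N)) (cycle_class 1 [:: 1%N]) = 0.
    by apply/eqP; apply/negPn/negP => /(supp _ p1).
  rewrite mass_class //= /mass => u0; apply/ffunP => g; rewrite ffunE -[RHS]u0.
  rewrite (bigD1 g) /= ?big1 ?addr0 // => [h|].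
    by case/andP=> _ /eqP[]; apply/permP => -[].
  rewrite inE; have /and3P[_ g0] := cycle_type_partn g.
  by case: (cycle_type g) g0 => // -[|x] s.
move=> dw dw'; elim=> [|n IHn]; first by rewrite !w0.
have [_ /(_ n)[eq_w _ _]] := dw; have [_ /(_ n)[eq_w' _ _]] := dw'.
by apply: (addIr (star (w n))); rewrite -eq_w -IHn -eq_w'.
Qed.

Lemma rect_part_overlap n la : (0 < n)%N -> is_partn n.+1 la ->
  charges (rect_part n.+1) la /\ charges (star (rect_part n)) la <->
  la = nseq n.+1 1%N.
Proof.
move=> n_gt0 la_n; rewrite /charges mass_class // mass_star // /almost_rect_mass.
split=> [[rect_la]|->].
  have [a [b [_ _ ab_n ->]]] := rect_mass_rectangular la_n rect_la.
  case: ifP => [|_]; last by rewrite eqxx.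
  by rewrite mem_nseq => /andP[_ /eqP b1] _; rewrite -ab_n -b1 muln1.
by rewrite mem_head /= !(@rect_mass_nseq_neq0 n.+1, rect_mass_nseq_neq0).
Qed.

End Masses.

Theorem theorem3p1 (R : realFieldType) :
  [/\
      forall n : nat, (1 <= n)%N -> forall la : seq nat, is_partn n la ->
        (charges (splitting1 R n) la <->
         rectangular n la \/ almost_rectangular n la),
      exists w : forall n : nat, {ffun 'S_n -> R},
        [/\ splitting1_decomposition w,
            forall w' : forall n : nat, {ffun 'S_n -> R},
              splitting1_decomposition w' -> forall n : nat, w' n = w n
          & forall n : nat, (1 <= n)%N ->
              forall la : seq nat, is_partn n.+1 la ->
              (charges (w n.+1) la /\ charges (star (w n)) la <->
               la = nseq n.+1 1%N)]
    &
      forall n : nat, (2 <= n)%N ->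
        mass (splitting1 R n) (cycle_class n (nseq n 1%N)) =
        (-1) ^+ n / (n * n.-1)%:R].
Proof.
split.
- by move=> n n_gt0 la la_n; apply: splitting1_support.
- exists (rect_part R); split.
  + exact: rect_part_decomposition.
  + by move=> w'; apply: decomposition_unique; exact: rect_part_decomposition.
  + by move=> n n_gt0 la la_n; apply: rect_part_overlap.
- by move=> n n_gt1; rewrite mass_class ?partn_ones // splitting1_mass_ones.
Qed.
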